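(* Let $m$ be a non-negative integer, let $S_m(x):=\int_{0}^{x}\sin^{2m+1}(\pi t)\,dt$ and $\mathcal{T}_m(x):=S_m(x)/S_m(1)$ for $0\le x\le 1$. Then $$\mathcal{T}_m(x)=\frac{1}{2}-\frac{1}{2a_m}\sum_{j=0}^{m}a_{m,j}\cos((2j+1)\pi x),\qquad 0\le x\le 1,$$ where $$a_{m,j}=\frac{(-1)^{m-j}}{2j+1}\binom{2m+1}{m-j},\qquad j=0,\dots,m,$$ and $a_m=a_{m,0}+\cdots+a_{m,m}$. *)

(* Defs.v *)
From Stdlib Require Import Reals.
From Coquelicot Require Import Coquelicot.

Open Scope R_scope.

Definition S_ (m : nat) (x : R) : R :=
  RInt (fun t => sin (PI * t) ^ (2 * m + 1)) 0 x.

Definition T_ (m : nat) (x : R) : R := S_ m x / S_ m 1.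

(* [Binomial.C] is qualified because Coquelicot's [C] is the type of complex
   numbers.  The truncated subtraction [m - j] is only used for [j <= m]. *)
Definition a_coef (m j : nat) : R :=
  (-1) ^ (m - j) / INR (2 * j + 1) * Binomial.C (2 * m + 1) (m - j).

(* [sum_f_R0 f m] is f 0 + ... + f m, with both ends included. *)
Definition a_sum (m : nat) : R := sum_f_R0 (a_coef m) m.

(* Main.v *)
Require Import Defs.
From Stdlib Require Import Reals Lra Lia.
From Coquelicot Require Import Coquelicot.

Open Scope R_scope.

(** Up to a constant factor, the right-hand side is the antiderivative of the
    integrand, read off from its finite Fourier expansion.  The numbers
    [(2 * j + 1) * a_coef m j] are, up to the factor [(-1) ^ m * 4 ^ m],
    the Fourier coefficients of an odd power of the sine:
      [(-1) ^ m * 4 ^ m * sin t ^ (2 * m + 1)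
         = sum_j (-1) ^ (m - j) * C (2 * m + 1) (m - j) * sin ((2 * j + 1) * t)]
    (lemma [sin_odd_power]).  Integrating term by term produces the factors
    [1 / (2 * j + 1)] and gives, with [B x] the cosine sum of the theorem,
      [(-1) ^ m * 4 ^ m * PI * S_ m x = B 0 - B x]
    (lemma [S_closed_form]).  Here [B 0 = a_sum m] and [B 1 = - a_sum m], so that
    [S_ m 1] is [2 * a_sum m] over the same constant, and the constant cancels
    in the quotient [T_ m x].  Dividing is legitimate because [S_ m 1] is the
    integral of a function that is positive on the open unit interval; hence
    [a_sum m] is nonzero too.

    The Fourier expansion is the [n]-th central difference of the sine in
    disguise.  One central difference of step [2 * t] multiplies by [2 * sin t]
    and shifts the phase by [PI / 2]; iterating it [n] times gives
    [(2 * sin t) ^ n] on one side and an alternating binomial sum on the other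
    (lemma [sin_central_difference]).  For odd [n] and phase [0] the terms [k]
    and [n - k] of that sum agree, and folding it leaves the [m + 1] terms
    above. *)

(** Summation by parts for Pascal's rule.  Truncating at [p] leaves a boundary
    term, which makes an induction on [p] with [n] fixed go through. *)
Lemma alternating_binomial_partial (u : nat -> R) (n p : nat) :
  (p <= n)%nat ->
  sum_f_R0 (fun k => (-1) ^ k * Binomial.C n k * (u k - u (S k))) p =
  sum_f_R0 (fun k => (-1) ^ k * Binomial.C (S n) k * u k) p
    - (-1) ^ p * Binomial.C n p * u (S p).
Proof.
  induction p as [|p IH]; intros Hp.
  - simpl. rewrite !C_n_0. ring.
  - rewrite !tech5, IH by lia. rewrite <- (pascal n p) by lia.
    simpl pow. ring.
Qed.

(** At [p = n] the boundary term above is the missing last term of the longer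
    sum.  This is the composition law of finite differences, and it drives the
    induction for [sin_central_difference]. *)
Lemma alternating_binomial_step (u : nat -> R) (n : nat) :
  sum_f_R0 (fun k => (-1) ^ k * Binomial.C (S n) k * u k) (S n) =
  sum_f_R0 (fun k => (-1) ^ k * Binomial.C n k * (u k - u (S k))) n.
Proof.
  rewrite alternating_binomial_partial, tech5, !C_n_n by lia.
  simpl pow. ring.
Qed.

(** The folded sum is indexed from the centre outwards, [j] being the distance
    to the middle, because this is the order of the frequencies [2 * j + 1]. *)
Lemma sum_fold_symmetric (g : nat -> R) (m : nat) :
  (forall k, (k <= m)%nat -> g (2 * m + 1 - k)%nat = g k) ->
  sum_f_R0 g (2 * m + 1) = 2 * sum_f_R0 (fun j => g (m - j)%nat) m.
Proof.
  intros Hg.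
  rewrite (tech2 g m) by lia.
  replace (2 * m + 1 - S m)%nat with m by lia.
  rewrite (sum_eq (fun i => g (S m + i)%nat) (fun j => g (m - j)%nat)).
  - rewrite sum_f_R0_skip. ring.
  - intros i Hi. rewrite <- (Hg (m - i)%nat) by lia. f_equal. lia.
Qed.

(** The phase [phi] has to be general: each difference turns the sine into a
    cosine, that is, moves the phase by [PI / 2]. *)
Lemma sin_central_difference (n : nat) (phi t : R) :
  sum_f_R0 (fun k => (-1) ^ k * Binomial.C n k *
                     sin (phi + (INR n - 2 * INR k) * t)) n =
  (2 * sin t) ^ n * sin (phi + INR n * (PI / 2)).
Proof.
  revert phi. induction n as [|n IH]; intros phi.
  - simpl. rewrite C_n_0. replace (phi + (0 - 2 * 0) * t) with phi by ring.
    replace (phi + 0 * (PI / 2)) with phi by ring. ring.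
  - rewrite alternating_binomial_step.
    rewrite (sum_eq _ (fun k => (-1) ^ k * Binomial.C n k *
      sin ((phi + PI / 2) + (INR n - 2 * INR k) * t) * (2 * sin t))).
    + rewrite <- scal_sum, IH, S_INR. simpl pow.
      replace (phi + (INR n + 1) * (PI / 2))
        with (phi + PI / 2 + INR n * (PI / 2)) by ring.
      ring.
    + intros k _. rewrite form4, !S_INR.
      replace ((phi + (INR n + 1 - 2 * INR k) * t +
                (phi + (INR n + 1 - 2 * (INR k + 1)) * t)) / 2)
        with (phi + (INR n - 2 * INR k) * t) by field.
      replace ((phi + (INR n + 1 - 2 * INR k) * t -
                (phi + (INR n + 1 - 2 * (INR k + 1)) * t)) / 2)
        with t by field.
      rewrite cos_sin.
      replace (PI / 2 + (phi + (INR n - 2 * INR k) * t))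
        with (phi + PI / 2 + (INR n - 2 * INR k) * t) by ring.
      ring.
Qed.

Lemma INR_odd (j : nat) : INR (2 * j + 1) = 2 * INR j + 1.
Proof. rewrite plus_INR, mult_INR. simpl. ring. Qed.

Lemma sin_odd_half_PI (m : nat) : sin (INR (2 * m + 1) * (PI / 2)) = (-1) ^ m.
Proof.
  induction m as [|m IH].
  - simpl. rewrite Rmult_1_l. apply sin_PI2.
  - rewrite INR_odd, S_INR.
    replace ((2 * (INR m + 1) + 1) * (PI / 2))
      with ((2 * INR m + 1) * (PI / 2) + PI) by field.
    rewrite neg_sin, <- INR_odd, IH. simpl. ring.
Qed.

Lemma cos_odd_PI (j : nat) : cos (INR (2 * j + 1) * PI) = -1.
Proof.
  rewrite INR_odd.
  replace ((2 * INR j + 1) * PI) with (PI + 2 * INR j * PI) by ring.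
  rewrite cos_period. apply cos_PI.
Qed.

Lemma pow_m1_complement (m k : nat) :
  (k <= 2 * m + 1)%nat -> (-1) ^ (2 * m + 1 - k) = - (-1) ^ k.
Proof.
  intros Hk.
  assert (Hkk : (-1) ^ k * (-1) ^ k = 1).
  { rewrite <- Rpow_mult_distr.
    replace (-1 * -1) with 1 by ring. apply pow1. }
  assert (H : (-1) ^ (2 * m + 1 - k) * (-1) ^ k = -1).
  { rewrite <- pow_add.
    replace (2 * m + 1 - k + k)%nat with (S (2 * m)) by lia.
    apply pow_1_odd. }
  replace ((-1) ^ (2 * m + 1 - k))
    with ((-1) ^ (2 * m + 1 - k) * (-1) ^ k * (-1) ^ k)
    by (rewrite Rmult_assoc, Hkk; ring).
  rewrite H. ring.
Qed.

Lemma sin_odd_power (m : nat) (t : R) :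
  sum_f_R0 (fun j => a_coef m j * INR (2 * j + 1) * sin (INR (2 * j + 1) * t)) m
  = (-1) ^ m * 4 ^ m * sin t ^ (2 * m + 1).
Proof.
  set (g := fun k => (-1) ^ k * Binomial.C (2 * m + 1) k *
                     sin (0 + (INR (2 * m + 1) - 2 * INR k) * t)).
  rewrite (sum_eq _ (fun j => g (m - j)%nat)).
  - assert (Hfold : sum_f_R0 g (2 * m + 1) =
                    2 * sum_f_R0 (fun j => g (m - j)%nat) m).
    { apply sum_fold_symmetric. intros k Hk. unfold g.
      (* Sign and sine both change under [k -> 2 * m + 1 - k]. *)
      rewrite pow_m1_complement by lia.
      rewrite <- (pascal_step1 (2 * m + 1) k) by lia.
      rewrite (minus_INR (2 * m + 1) k) by lia.
      replace (0 + (INR (2 * m + 1) - 2 * (INR (2 * m + 1) - INR k)) * t)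
        with (- (0 + (INR (2 * m + 1) - 2 * INR k) * t)) by ring.
      rewrite sin_neg. ring. }
    unfold g at 1 in Hfold.
    rewrite sin_central_difference, Rplus_0_l, sin_odd_half_PI in Hfold.
    rewrite Rpow_mult_distr, (pow_add 2), (pow_mult 2) in Hfold.
    replace (2 ^ 2) with 4 in Hfold by ring.
    lra.
  - intros j Hj. unfold g, a_coef.
    rewrite (minus_INR m j) by lia.
    replace (0 + (INR (2 * m + 1) - 2 * (INR m - INR j)) * t)
      with (INR (2 * j + 1) * t) by (rewrite !INR_odd; ring).
    field. apply not_0_INR. lia.
Qed.

Lemma is_derive_sum_f_R0 (f df : nat -> R -> R) (x : R) (n : nat) :
  (forall j, is_derive (f j) x (df j x)) ->
  is_derive (fun y => sum_f_R0 (fun j => f j y) n) x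
            (sum_f_R0 (fun j => df j x) n).
Proof.
  intros H. induction n as [|n IH]; simpl.
  - apply H.
  - apply (is_derive_plus (fun y => sum_f_R0 (fun j => f j y) n) (f (S n)));
      [exact IH | apply H].
Qed.

Definition cosine_sum (m : nat) (x : R) : R :=
  sum_f_R0 (fun j => a_coef m j * cos (INR (2 * j + 1) * PI * x)) m.

Lemma cosine_sum_0 (m : nat) : cosine_sum m 0 = a_sum m.
Proof.
  apply sum_eq. intros j _. rewrite Rmult_0_r, cos_0. ring.
Qed.

Lemma cosine_sum_1 (m : nat) : cosine_sum m 1 = - a_sum m.
Proof.
  unfold cosine_sum, a_sum.
  replace (- sum_f_R0 (a_coef m) m) with (-1 * sum_f_R0 (a_coef m) m) by ring.
  rewrite scal_sum.
  apply sum_eq. intros j _. rewrite Rmult_1_r, cos_odd_PI. reflexivity.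
Qed.

(** The odd multipliers that differentiation brings down cancel the denominators
    of [a_coef], which leaves exactly the expansion of [sin_odd_power]. *)
Lemma is_derive_cosine_sum (m : nat) (x : R) :
  is_derive (cosine_sum m) x
    (- PI * ((-1) ^ m * 4 ^ m * sin (PI * x) ^ (2 * m + 1))).
Proof.
  rewrite <- sin_odd_power, scal_sum.
  apply (is_derive_sum_f_R0
    (fun j y => a_coef m j * cos (INR (2 * j + 1) * PI * y))
    (fun j y => a_coef m j * INR (2 * j + 1) *
                sin (INR (2 * j + 1) * (PI * y)) * - PI)).
  intros j. auto_derive; [exact I|].
  change (j + (j + 0) + 1)%nat with (2 * j + 1)%nat.
  rewrite (Rmult_assoc (INR _) PI x). ring.
Qed.

Lemma continuous_sin_pow (n : nat) (x : R) :
  continuous (fun t => sin (PI * t) ^ n) x.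
Proof.
  apply (ex_derive_continuous (fun t => sin (PI * t) ^ n)).
  auto_derive. exact I.
Qed.

Lemma sign_four_pow_neq_0 (m : nat) : (-1) ^ m * 4 ^ m <> 0.
Proof.
  apply Rmult_integral_contrapositive_currified; apply pow_nonzero; lra.
Qed.

Lemma S_closed_form (m : nat) (x : R) :
  S_ m x = (a_sum m - cosine_sum m x) / ((-1) ^ m * 4 ^ m * PI).
Proof.
  pose proof (sign_four_pow_neq_0 m) as HK.
  pose proof PI_neq0 as HPI.
  set (K := (-1) ^ m * 4 ^ m) in *.
  unfold S_. apply is_RInt_unique.
  replace ((a_sum m - cosine_sum m x) / (K * PI))
    with (minus (- / (K * PI) * cosine_sum m x) (- / (K * PI) * cosine_sum m 0)).
  - apply (is_RInt_derive (fun y => - / (K * PI) * cosine_sum m y)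
             (fun t => sin (PI * t) ^ (2 * m + 1))).
    + intros y _.
      replace (sin (PI * y) ^ (2 * m + 1)) with
        (- / (K * PI) * (- PI * (K * sin (PI * y) ^ (2 * m + 1))))
        by (field; auto).
      apply (is_derive_scal (cosine_sum m)). apply is_derive_cosine_sum.
    + intros y _. apply continuous_sin_pow.
  - rewrite cosine_sum_0. unfold minus, plus, opp; simpl. field. auto.
Qed.

(** This positivity is what excludes [a_sum m = 0]: an alternating sum gives no
    direct control of its sign. *)
Lemma S_1_pos (m : nat) : 0 < S_ m 1.
Proof.
  apply RInt_gt_0.
  - lra.
  - intros t Ht. apply pow_lt. pose proof PI_RGT_0. apply sin_gt_0; nra.
  - intros t _. apply continuous_sin_pow.
Qed.

Theorem corollary6 (m : nat) (x : R) (hx : 0 <= x <= 1) :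
  T_ m x =
    1 / 2 - 1 / (2 * a_sum m) *
      sum_f_R0 (fun j => a_coef m j * cos (INR (2 * j + 1) * PI * x)) m.
Proof.
  fold (cosine_sum m x).
  assert (Ha : a_sum m <> 0).
  { (* Otherwise [S_closed_form] would give [S_ m 1 = 0]. *)
    intros Ha. pose proof (S_1_pos m) as HS.
    rewrite S_closed_form, cosine_sum_1, Ha in HS.
    unfold Rdiv in HS. rewrite Ropp_0, Rminus_0_r, Rmult_0_l in HS. lra. }
  unfold T_. rewrite !S_closed_form, cosine_sum_1.
  pose proof (sign_four_pow_neq_0 m) as HK.
  pose proof PI_neq0 as HPI.
  set (K := (-1) ^ m * 4 ^ m) in *.
  field. repeat split; auto; lra.
Qed.
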